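(* Let $S\subset\mathbb{N}\oplus\mathbb{Z}^n$ be an ample graded semigroup with restricted growth. Then: 1) the cone $\mathrm{Con}(S)$ is strictly convex, i.e. the Newton convex set $\Delta(S)$ is bounded; 2) for $k>0$ let $d(k)$ be the maximum of the distances from the points $(k,x)$ to the boundary of $\mathrm{Con}(S)$, over $x\in M_S(k)\setminus S_k$ (with $d(k)=0$ if this set is empty). Then $\lim_{k\to\infty} d(k)/k=0$.
   Context: For a subsemigroup $S\subset\mathbb{N}\oplus\mathbb{Z}^n$ and $k>0$, $S_k=\{x\in\mathbb{Z}^n:(k,x)\in S\}$. $S$ is graded if each $S_k$ ($k>0$) is finite and non-empty; ample if there is $m$ such that the differences $a-b$, $a,b\in S_m$, generate $\mathbb{Z}^n$; of restricted growth if there is a constant $C$ with $\#S_k\le Ck^n$ for all $k>0$. $\mathrm{Con}(S)\subset\mathbb{R}^{n+1}$ is the closed convex cone generated by $S\cup\{0\}$; $M_S=\mathrm{Con}(S)\cap(\mathbb{N}\oplus\mathbb{Z}^n)$ and $M_S(k)=\{x:(k,x)\in M_S\}$. The Newton convex set is $\Delta(S)=\{x\in\mathbb{R}^n:(1,x)\in\mathrm{Con}(S)\}$. *)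

(* Defs.v *)
From HB Require Import structures.
From mathcomp Require Import all_boot all_order all_algebra.
From mathcomp Require Import all_classical all_reals all_analysis.
Unset Printing Implicit Defensive.
Import Order.TTheory GRing.Theory Num.Theory.
Import numFieldNormedType.Exports.
Local Open Scope classical_set_scope.
Local Open Scope ring_scope.

Definition lattice_pt (n : nat) := (nat * 'rV[int]_n)%type.

Definition is_subsemigroup {n} (S : set (lattice_pt n)) : Prop :=
  forall a b, S a -> S b -> S ((a.1 + b.1)%N, a.2 + b.2).

Definition slice {n} (S : set (lattice_pt n)) (k : nat) : set 'rV[int]_n :=
  [set x | S (k, x)].

Definition graded {n} (S : set (lattice_pt n)) : Prop :=
  forall k : nat, (0 < k)%N -> finite_set (slice S k) /\ slice S k !=set0.

Definition in_diff_subgroup {n} (A : set 'rV[int]_n) (z : 'rV[int]_n) : Prop :=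
  exists s : seq ('rV[int]_n * 'rV[int]_n * int),
    (forall t, t \in s -> A t.1.1 /\ A t.1.2) /\
    z = \sum_(t <- s) ((t.1.1 - t.1.2) *~ t.2).

Definition ample {n} (S : set (lattice_pt n)) : Prop :=
  exists m : nat, forall z : 'rV[int]_n, in_diff_subgroup (slice S m) z.

(* #S_k <= C k^n for all k > 0 (#A <= N iff every duplicate-free list of
   elements of A has length <= N) *)
Definition restricted_growth (R : realType) {n} (S : set (lattice_pt n)) : Prop :=
  exists C : R, forall k : nat, (0 < k)%N ->
    forall s : seq 'rV[int]_n, uniq s -> (forall x, x \in s -> slice S k x) ->
      (size s)%:R <= C * (k%:R) ^+ n.

Definition ext {R : realType} {n} (t : R) (y : 'rV[R]_n) : 'rV[R]_n.+1 :=
  \row_(i < n.+1) match unlift ord0 i with None => t | Some j => y ord0 j end.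

Definition emb (R : realType) {n} (p : lattice_pt n) : 'rV[R]_n.+1 :=
  ext ((p.1)%:R : R) (map_mx (fun z : int => z%:~R) p.2).

Definition conic_hull {R : realType} {m} (A : set 'rV[R]_m) : set 'rV[R]_m :=
  [set v | exists s : seq (R * 'rV[R]_m),
      (forall t, t \in s -> 0 <= t.1 /\ A t.2) /\
      v = \sum_(t <- s) (t.1 *: t.2)].

Definition Con (R : realType) {n} (S : set (lattice_pt n)) : set 'rV[R]_n.+1 :=
  closure (conic_hull (emb R @` S)).

Definition M_S (R : realType) {n} (S : set (lattice_pt n)) (k : nat) : set 'rV[int]_n :=
  [set x | Con R S (emb R (k, x))].

Definition Newton (R : realType) {n} (S : set (lattice_pt n)) : set 'rV[R]_n :=
  [set y | Con R S (ext (1 : R) y)].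

Definition strictly_convex_cone {R : realType} {m} (K : set 'rV[R]_m) : Prop :=
  forall v, K v -> K (- v) -> v = 0.

Definition bounded_rV {R : realType} {m} (A : set 'rV[R]_m) : Prop :=
  exists M : R, forall y, A y -> forall i, `|y ord0 i| <= M.

Definition eucl_norm {R : realType} {m} (v : 'rV[R]_m) : R :=
  Num.sqrt (\sum_(i < m) (v ord0 i) ^+ 2).

Definition dist_to {R : realType} {m} (p : 'rV[R]_m) (B : set 'rV[R]_m) : R :=
  inf [set eucl_norm (p - q) | q in B].

Definition boundary {R : realType} {m} (B : set 'rV[R]_m) : set 'rV[R]_m :=
  closure B `\` interior B.

(* d(k): max of the distances from (k,x) to the boundary of Con(S),
   over x in M_S(k) \ S_k; 0 if this set is empty (distances are >= 0,
   so adjoining 0 does not change the maximum). *)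
Definition dfun (R : realType) {n} (S : set (lattice_pt n)) (k : nat) : R :=
  sup ([set 0] `|`
       [set dist_to (emb R (k, x)) (boundary (Con R S)) | x in M_S R S k `\` slice S k]).

(* Main.v *)
(** If S_m contains n+1 linearly independent points and some (k,y) in S had y/k far
    from their convex hull, then, restricted growth being a bound on volumes, the
    semigroup spanned by these points and (k,y) would have too many points on some
    level.  Hence |y| <= B k on S, so Con(S) lies in a strictly convex cone.

    For the second part, fix a finite A in S that generates Z^(n+1) and whose cone
    approximates Con(S) up to a small relative error.  A lattice point v deep inside
    Con(S) stays deep after subtracting Z copies of the sum of A, and the difference is
    then within distance 1 of the cone of A.  Rounding down its coefficients leaves a
    lattice vector of bounded size, which is an integral combination of A with
    coefficients at least -Z; thus v is a nonnegative combination of A. *)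
Require Import Defs.
From HB Require Import structures.
From mathcomp Require Import all_boot all_order all_algebra.
From mathcomp Require Import all_classical all_reals all_analysis.
From mathcomp Require Import lra.
Import Order.TTheory GRing.Theory Num.Theory.
Import numFieldNormedType.Exports.
Local Open Scope classical_set_scope.
Local Open Scope ring_scope.

(** * Lattice points as integer rows, and the monoid of [S] *)

Lemma ler_coord_norm {R : realType} {m : nat} (v : 'rV[R]_m) (i : 'I_m) :
  `|v ord0 i| <= `|v|.
Proof.
rewrite [leRHS]/Num.norm /= mx_normrE; apply/bigmax_geP; right => /=.
by exists (ord0, i).
Qed.

(** The level of a [lattice_pt] is a natural number and cannot be subtracted; integer rows form a
    group, and [emb] is the entrywise cast of [lat]. *)
Definition lat {n : nat} (p : lattice_pt n) : 'rV[int]_n.+1 :=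
  \row_(i < n.+1) match unlift ord0 i with
                  | None => p.1%:Z | Some j => p.2 ord0 j end.

Definition tail {n : nat} (w : 'rV[int]_n.+1) : 'rV[int]_n :=
  \row_(j < n) w ord0 (lift ord0 j).

Lemma lat0 {n : nat} (p : lattice_pt n) : lat p ord0 ord0 = p.1%:Z.
Proof. by rewrite mxE unlift_none. Qed.

Lemma tail_lat {n : nat} (p : lattice_pt n) : tail (lat p) = p.2.
Proof. by apply/rowP => j; rewrite !mxE liftK. Qed.

Lemma row_head_tail {n : nat} (w w' : 'rV[int]_n.+1) :
  w ord0 ord0 = w' ord0 ord0 -> tail w = tail w' -> w = w'.
Proof.
move=> h t; apply/rowP => i; case: (unliftP ord0 i) => [j|] -> //.
by have /rowP/(_ j) := t; rewrite !mxE.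
Qed.

Lemma latD {n : nat} (a b : lattice_pt n) :
  lat ((a.1 + b.1)%N, a.2 + b.2) = lat a + lat b.
Proof. by apply/rowP => i; rewrite !mxE; case: unlift => [j|] //=; rewrite mxE. Qed.

Lemma emb_lat {R : realType} {n : nat} (p : lattice_pt n) :
  emb R p = map_mx intr (lat p).
Proof. by apply/rowP => i; rewrite !mxE; case: unlift => [j|] //=; rewrite mxE. Qed.

Lemma emb0 {R : realType} {n : nat} (p : lattice_pt n) :
  emb R p ord0 ord0 = p.1%:R.
Proof. by rewrite emb_lat mxE lat0. Qed.

Section LatticeMonoid.
Context {n : nat} (S : set (lattice_pt n)).
Hypothesis Ssg : is_subsemigroup S.

(** The origin is adjoined so that empty sums and zero multiples stay inside. *)
Definition monoid_of (w : 'rV[int]_n.+1) : Prop :=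
  exists2 v, lat v = w & S v \/ v = (0%N, 0).

Lemma monoid_of0 : monoid_of 0.
Proof.
exists (0%N, 0); last by right.
by apply/rowP => i; rewrite !mxE; case: unlift => //= j; rewrite mxE.
Qed.

Lemma monoid_of_lat p : S p -> monoid_of (lat p).
Proof. by move=> Sp; exists p => //; left. Qed.

Lemma monoid_ofD w w' : monoid_of w -> monoid_of w' -> monoid_of (w + w').
Proof.
move=> [a <- ha] [b <- hb]; exists ((a.1 + b.1)%N, a.2 + b.2); first exact: latD.
case: ha => [Sa|->]; case: hb => [Sb|->] /=.
- by left; exact: Ssg.
- by left; rewrite addn0 addr0 -surjective_pairing.
- by left; rewrite add0n add0r -surjective_pairing.
- by right; rewrite addr0.
Qed.

Lemma monoid_ofMn w k : monoid_of w -> monoid_of (w *+ k).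
Proof.
move=> hw; elim: k => [|k ih]; first by rewrite mulr0n; exact: monoid_of0.
by rewrite mulrS; exact: monoid_ofD.
Qed.

Lemma monoid_of_sum (I : Type) (r : seq I) (P : pred I) (F : I -> 'rV_n.+1) :
  (forall i, P i -> monoid_of (F i)) -> monoid_of (\sum_(i <- r | P i) F i).
Proof. by move=> h; apply: big_ind => //; [exact: monoid_of0|exact: monoid_ofD]. Qed.

Lemma monoid_of_slice w k : (0 < k)%N -> monoid_of w -> w ord0 ord0 = k%:Z ->
  slice S k (tail w).
Proof.
move=> k0 [v <- hv]; rewrite lat0 tail_lat => -[vk]; case: hv => [Sv|ve].
  by rewrite /slice /= -vk -surjective_pairing.
by move: k0; rewrite -vk ve.
Qed.

(** A nonzero [x] at level 0 would put all the distinct translates [b + x *+ j] of a point [b] into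
    the slice at level 1, against the growth bound there. *)
Lemma slice0 (R : realType) x : graded S -> restricted_growth R S ->
  S (0%N, x) -> x = 0.
Proof.
move=> gr [C hC] Sx; have [_ [b Sb]] := gr 1%N isT.
apply/eqP/negPn/negP => x0.
have Sbx j : slice S 1 (b + x *+ j).
  elim: j => [|j ih]; first by rewrite mulr0n addr0.
  have := Ssg _ _ ih Sx; rewrite /slice /= addn0 mulrS.
  by rewrite (addrC x) addrA.
pose N := (Num.bound `|C|).+1.
have := hC 1%N isT [seq b + x *+ j | j <- iota 0 N].
rewrite expr1n mulr1 size_map size_iota => /(_ _ _) h.
suff: N%:R <= C.
  rewrite leNgt => /negP; apply; apply: le_lt_trans (ler_norm C) _.
  by apply: lt_le_trans (archi_boundP (normr_ge0 C)) _; rewrite ler_nat.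
apply: h => [|y /mapP[j _ ->]]; last exact: Sbx.
rewrite map_inj_uniq ?iota_uniq // => i j /addrI e.
have [k xk] : exists k, x ord0 k != 0.
  apply/existsP; apply: contra_neqT x0; rewrite negb_exists => /forallP h0.
  by apply/rowP => k; rewrite mxE; apply/eqP/negPn/h0.
move/rowP/(_ k): e; rewrite !mulmxnE.
wlog ij : i j / (i <= j)%N.
  by move=> h1; case: (leqP i j) => [|/ltnW] ij e; [apply: h1|apply/esym; apply: h1].
move=> e; apply/eqP; rewrite eqn_leq ij /= -subn_eq0.
have : x ord0 k *+ (j - i) = 0 by rewrite mulrnBr // e subrr.
by move/eqP; rewrite mulrn_eq0 (negbTE xk) orbF.
Qed.

(** Ampleness allows [m = 0]. By [slice0] the differences at level 0 vanish, so in that case the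
    whole group is zero and level 1 serves with the empty combination. *)
Lemma ample_pos (R : realType) : graded S -> restricted_growth R S -> ample S ->
  exists2 m, (0 < m)%N & forall z, in_diff_subgroup (slice S m) z.
Proof.
move=> gr rg [m hm]; case: (posnP m) => [m0|m0]; last by exists m.
exists 1%N => // z; have -> : z = 0; last by exists [::]; rewrite big_nil.
have [s [hs ->]] := hm z; rewrite big_seq big1 // => t ts.
have [] := hs _ ts; rewrite m0 => /(slice0 _ _ gr rg) -> /(slice0 _ _ gr rg) ->.
by rewrite subrr mul0rz.
Qed.

End LatticeMonoid.

(** * Integral combinations of a finite list of lattice points *)

Section IntegerSpan.
Context {n : nat} (A : seq (lattice_pt n)).

Definition int_span (w : 'rV[int]_n.+1) : Prop :=
  exists z : lattice_pt n -> int, w = \sum_(p <- A) lat p *~ z p.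

Lemma int_span0 : int_span 0.
Proof. by exists (fun=> 0); rewrite big1. Qed.

Lemma int_spanD w w' : int_span w -> int_span w' -> int_span (w + w').
Proof.
move=> [z ->] [z' ->]; exists (fun p => z p + z' p); rewrite -big_split /=.
by apply: eq_bigr => p _; rewrite mulrzDr.
Qed.

Lemma int_spanMz w c : int_span w -> int_span (w *~ c).
Proof.
move=> [z ->]; exists (fun p => z p * c); rewrite mulrz_suml.
by apply: eq_bigr => p _; rewrite mulrzA.
Qed.

Lemma int_spanB w w' : int_span w -> int_span w' -> int_span (w - w').
Proof.
move=> hw hw'; apply: int_spanD => //.
by rewrite -[w']mulr1z -mulrNz; exact: int_spanMz.
Qed.

Lemma int_span_sum (I : eqType) (r : seq I) (F : I -> 'rV_n.+1) :
  (forall i, i \in r -> int_span (F i)) -> int_span (\sum_(i <- r) F i).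
Proof.
move=> h; rewrite big_seq; apply: big_ind => //; [exact: int_span0|exact: int_spanD].
Qed.

Lemma int_span_mem p : uniq A -> p \in A -> int_span (lat p).
Proof.
move=> uA pA; exists (fun x => (x == p)%:Z); rewrite (bigD1_seq p) //= eqxx.
by rewrite big1 ?addr0 // => x /negbTE ->.
Qed.

(** A difference of two points of the slice at [m] lifts to a difference of two members of [A], in
    which the levels cancel. *)
Lemma int_span_level0 (S : set (lattice_pt n)) (m : nat) (w : 'rV[int]_n.+1) :
  uniq A -> (forall a, slice S m a -> (m, a) \in A) ->
  (forall z, in_diff_subgroup (slice S m) z) -> w ord0 ord0 = 0 -> int_span w.
Proof.
move=> uA mA hm w0; have [s [hs ws]] := hm (tail w).
have -> : w = \sum_(t <- s) (lat (m, t.1.1) - lat (m, t.1.2)) *~ t.2.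
  apply: row_head_tail.
    rewrite w0 summxE big1 // => t _.
    by rewrite -scaler_int !mxE unlift_none subrr mulr0.
  rewrite ws; apply/rowP => j; rewrite mxE !summxE; apply: eq_bigr => t _.
  by rewrite -!scaler_int !mxE liftK.
apply: int_span_sum => t /hs[h1 h2]; apply: int_spanMz.
by apply: int_spanB; apply: int_span_mem => //; apply: mA.
Qed.

Lemma map_lat_sum (R : realType) (z : lattice_pt n -> int) :
  map_mx intr (\sum_(p <- A) lat p *~ z p) =
  \sum_(p <- A) (z p)%:~R *: emb R p.
Proof.
rewrite raddf_sum; apply: eq_bigr => p _.
by rewrite scaler_int raddfMz emb_lat.
Qed.

End IntegerSpan.

(** * A basis inside one slice, and the linear bound on [S] *)

(** Up to a multiple of one point of the slice, [m] times a unit vector has level 0 and so is an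
    integral combination of the slice. Hence the slice spans the real space, and a basis can be
    chosen from it. *)
Lemma exists_slice_basis (R : realType) {n : nat} (S : set (lattice_pt n)) (m : nat) :
  graded S -> (0 < m)%N -> (forall z, in_diff_subgroup (slice S m) z) ->
  exists P : 'I_n.+1 -> lattice_pt n,
    [/\ forall i, S (P i), forall i, (P i).1 = m
      & (\matrix_i emb R (P i)) \in unitmx].
Proof.
move=> gr m0 hm; have [/finite_seqP[r hr] [a0 Sa0]] := gr m m0.
have memr a : slice S m a <-> a \in r by rewrite hr.
pose A := undup [seq (m, a) | a <- r].
have mA a : slice S m a -> (m, a) \in A.
  by move=> /memr ar; rewrite mem_undup; apply/mapP; exists a.
have AS p : p \in A -> S p /\ p.1 = m.
  by rewrite mem_undup => /mapP[a /memr Sa ->].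
have uA : uniq A by exact: undup_uniq.
pose d := (m, a0).
pose M := \matrix_(i < size A) emb R (nth d A i).
have rowA p : p \in A -> (emb R p <= M)%MS.
  move=> pA; have ps : (index p A < size A)%N by rewrite index_mem.
  have -> : emb R p = row (Ordinal ps) M by rewrite rowK /= nth_index.
  exact: row_sub.
have full : row_full M.
  rewrite -sub1mx; apply/row_subP => i; rewrite row1.
  (* [c] is 1 exactly for the level coordinate, which makes the level of [w] zero. *)
  pose c : int := (ord0 == i)%:R.
  pose w : 'rV[int]_n.+1 := delta_mx 0 i *+ m - lat d *~ c.
  have [z wz] : int_span A w.
    apply: (int_span_level0 _ S m) => //.
    rewrite /w -scaler_int !mxE mulmxnE unlift_none mxE eqxx /= intz.
    by rewrite -/c -mulr_natr natz subrr.
  have eR : delta_mx 0 i *+ m = map_mx intr w + emb R d *~ c :> 'rV[R]_n.+1.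
    rewrite /w raddfB /= raddfMz emb_lat subrK raddfMn /= map_delta_mx //.
  have -> : delta_mx 0 i = m%:R^-1 *: (delta_mx 0 i *+ m) :> 'rV[R]_n.+1.
    by rewrite -(scaler_nat m (delta_mx 0 i)) scalerA mulVf ?scale1r // pnatr_eq0 -lt0n.
  apply: scalemx_sub; rewrite eR; apply: addmx_sub.
    rewrite wz map_lat_sum big_seq; apply: summx_sub => p pA.
    by apply: scalemx_sub; exact: rowA.
  by rewrite -scaler_int; apply: scalemx_sub; apply: rowA; exact: mA.
exists (fun i => nth d A (fullrankfun full i)); split.
- by move=> i; have [] := AS _ (mem_nth d (ltn_ord (fullrankfun full i))).
- by move=> i; have [] := AS _ (mem_nth d (ltn_ord (fullrankfun full i))).
- have <- : rowsub (fullrankfun full) M =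
    \matrix_i emb R (nth d A (fullrankfun full i)).
    by apply/matrixP => i j; rewrite !mxE.
  exact: fullrowsub_unit.
Qed.

(* If a coordinate [c i0] of [q] were very negative, the sums of [m * l] copies
   of [q] ([l < Q]) and of [j i < q.1 * Q] copies of each [P i] but one would be
   distinct, because the [i0]-coordinate of the sum determines both [l] and [j i0].
   The remaining basis vector [P i1] brings all of them to the same level. *)
Lemma coord_gt (R : realType) {n : nat} (S : set (lattice_pt n))
    (P : 'I_n.+1 -> lattice_pt n) (m Q : nat) (C : R) (q : lattice_pt n)
    (c : 'I_n.+1 -> R) :
  is_subsemigroup S ->
  (forall k : nat, (0 < k)%N -> forall s : seq 'rV[int]_n, uniq s ->
     (forall x, x \in s -> slice S k x) -> (size s)%:R <= C * k%:R ^+ n) ->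
  (0 < m)%N -> (forall i, S (P i)) -> (forall i, (P i).1 = m) ->
  (\matrix_i emb R (P i)) \in unitmx ->
  (0 < Q)%N -> C * (m * n.+1)%:R ^+ n < Q%:R ->
  S q -> (0 < q.1)%N -> emb R q = \sum_i c i *: emb R (P i) ->
  forall i, - (q.1 * Q)%:R < m%:R * c i.
Proof.
case: n S P q c => [|n] S P q c Ssg hC m0 SP Pm uP Q0 CQ Sq k0 qc i0.
  (* For [n = 0] there is no second basis vector to adjust levels, but comparing levels gives
     [m * c = q.1] directly. *)
  have /rowP/(_ ord0) := qc; rewrite emb0 summxE big_ord1 mxE emb0 Pm (ord1 i0).
  rewrite mulrC => <-; apply: (@lt_le_trans _ _ 0); last exact: ler0n.
  by rewrite oppr_lt0 ltr0n muln_gt0 k0.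
rewrite ltNge; apply/negP => ci0.
set k := q.1 in k0 ci0.
pose i1 : 'I_n.+2 := lift i0 ord0.
pose T := ('I_Q * {ffun 'I_n.+1 -> 'I_(k * Q)})%type.
pose J (t : T) (i : 'I_n.+2) : nat :=
  match unlift i1 i with
  | None => (k * (n.+2 * Q) - k * t.1 - \sum_j t.2 j)%N
  | Some j => t.2 j end.
pose F (t : T) := lat q *+ (m * t.1) + \sum_i lat (P i) *+ J t i.
pose N := (m * (k * (n.+2 * Q)))%N.
have N0 : (0 < N)%N by rewrite !muln_gt0 m0 k0.
have sumJ (t : T) : (k * t.1 + \sum_i J t i = k * (n.+2 * Q))%N.
  have lifted : (\sum_j J t (lift i1 j) = \sum_j t.2 j)%N.
    by apply: eq_bigr => j _; rewrite /J liftK.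
  rewrite (bigD1_ord i1) //= lifted /J unlift_none.
  (* These bounds ensure that the truncated subtractions in [J] lose nothing. *)
  have h1 : (k * t.1 <= k * Q)%N by rewrite leq_mul // ltnW.
  have h2 : (\sum_j t.2 j <= n.+1 * (k * Q))%N.
    rewrite -[X in (_ <= X * _)%N](card_ord n.+1) -sum_nat_const.
    by apply: leq_sum => j _; apply: ltnW.
  rewrite subnK ?subnKC //.
    by apply: leq_trans h1 _; rewrite leq_mul // leq_pmull.
  rewrite leq_subRL; last by apply: leq_trans h1 _; rewrite leq_mul // leq_pmull.
  by rewrite mulSn mulnDr leq_add // mulnCA.
have Flev (t : T) : F t ord0 ord0 = N%:Z.
  rewrite /F mxE mulmxnE summxE lat0 -/k.
  under eq_bigr do rewrite mulmxnE lat0 Pm.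
  rewrite sumrMnr /N -(sumJ t) mulnDr PoszD.
  by rewrite -(mulr_natr k%:Z) -(mulr_natr m%:Z) !natz -!PoszM mulnCA.
have FS (t : T) : slice S N (tail (F t)).
  apply: monoid_of_slice => //.
  apply: monoid_ofD => //.
    by apply: monoid_ofMn => //; exact: monoid_of_lat.
  by apply: monoid_of_sum => // i _; apply: monoid_ofMn => //; exact: monoid_of_lat.
have FR (t : T) : map_mx intr (F t) =
    (\row_i ((m * t.1)%:R * c i + (J t i)%:R)) *m (\matrix_i emb R (P i)).
  rewrite /F raddfD raddfMn raddf_sum /= -emb_lat qc mulmx_sum_row.
  rewrite -sumrMnl -big_split /=; apply: eq_bigr => i _.
  by rewrite mxE rowK scalerDl raddfMn /= -emb_lat !scaler_nat -scalerA scaler_nat.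
have Finj : injective (fun t => tail (F t)).
  move=> [l f] [l' f'] e.
  have {e} e : F (l, f) = F (l', f') by apply: row_head_tail; rewrite ?Flev.
  have {e} e i : (m * l)%:R * c i + (J (l, f) i)%:R
             = (m * l')%:R * c i + (J (l', f') i)%:R.
    have := congr1 (map_mx (intr : int -> R)) e; rewrite !FR => /(can_inj (mulmxK uP)).
    by move=> /rowP/(_ i); rewrite !mxE.
  have Jlt (t : T) : (J t i0 < k * Q)%N.
    rewrite /J; case: unliftP => [j _|/eqP]; first exact: ltn_ord.
    by rewrite (negbTE (neq_lift _ _)).
  (* By [ci0], raising [l] by one lowers the [i0]-coordinate by at least [k * Q], which the change
     of [J] at [i0], being less than [k * Q], cannot make up. *)
  have nolt (a b : 'I_Q) (g h : {ffun 'I_n.+1 -> 'I_(k * Q)}) : (a < b)%N ->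
      (m * a)%:R * c i0 + (J (a, g) i0)%:R
        = (m * b)%:R * c i0 + (J (b, h) i0)%:R -> False.
    move=> ab; have := Jlt (b, h); rewrite -(ltr_nat R).
    have := ler0n R (J (a, g) i0); rewrite !natrM.
    have : a%:R + 1 <= b%:R :> R by rewrite natr1 ler_nat.
    move: ci0; rewrite natrM.
    have : 0 < k%:R * Q%:R :> R by rewrite mulr_gt0 ?ltr0n.
    nra.
  have ll : l = l'.
    apply: val_inj; case: (ltngtP l l') => // /nolt h; exfalso.
      exact: h (e i0).
    exact: h (esym (e i0)).
  rewrite -{}ll in e *; congr (_, _); apply/ffunP => j; apply: val_inj.
  have /addrI/eqP := e (lift i1 j).
  by rewrite eqr_nat /J liftK => /eqP.
have : (size [seq tail (F t) | t <- enum {: T}])%:R <= C * N%:R ^+ n.+1.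
  apply: hC => // [|_ /mapP[t _ ->]]; last exact: FS.
  by rewrite map_inj_uniq ?enum_uniq.
(* There are [Q * (k * Q) ^ n.+1] distinct points at level [N = m * n.+2 * (k * Q)], so the choice
   of [Q] contradicts restricted growth. *)
rewrite size_map -cardT card_prod card_ffun !card_ord natrM natrX.
rewrite leNgt => /negP; apply.
have -> : N = ((m * n.+2) * (k * Q))%N by rewrite /N mulnA mulnCA !mulnA -!mulnA mulnCA.
rewrite natrM exprMn mulrA ltr_pM2r //.
by rewrite exprn_gt0 // ltr0n muln_gt0 k0.
Qed.

(** In the basis [P], [coord_gt] bounds each coordinate of [q] from below; since [m] times their sum
    is the level [q.1], they are bounded above as well. *)
Lemma semigroup_linear_bound (R : realType) {n : nat} (S : set (lattice_pt n)) :
  is_subsemigroup S -> graded S -> ample S -> restricted_growth R S ->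
  exists2 B : R, 0 < B & forall q, S q -> `|emb R q| <= B * q.1%:R.
Proof.
move=> Ssg gr am rg; have [m m0 hm] := ample_pos S Ssg R gr rg am.
have [C hC] := rg.
have [P [SP Pm uP]] := exists_slice_basis R S m gr m0 hm.
pose M := \matrix_i emb R (P i).
pose Q := (Num.bound `|C * (m * n.+1)%:R ^+ n|).+1.
have CQ : C * (m * n.+1)%:R ^+ n < Q%:R.
  apply: le_lt_trans (ler_norm _) _; apply: lt_le_trans (archi_boundP (normr_ge0 _)) _.
  by rewrite ler_nat.
(* Each [m * c i] is at least [- k * Q] and they add up to [k], so each has absolute value at most
   [D * k]; dividing by [m >= 1] keeps this bound. *)
pose D : R := 1 + (n.+1 * Q)%:R.
pose B := 1 + D * \sum_i `|emb R (P i)|.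
have D0 : 0 < D by rewrite ltr_wpDr.
have sum0 : 0 <= \sum_i `|emb R (P i)| by apply: sumr_ge0.
exists B => [|[k y] Sq]; first by rewrite ltr_wpDr // mulr_ge0 // ltW.
case: (posnP k) => [k0|k0].
  rewrite k0 mulr0 in Sq *; have -> : y = 0 by apply: (slice0 S Ssg R).
  have -> : emb R (0%N, 0) = 0; last by rewrite normr0.
  by move=> n0; apply/rowP => i; rewrite !mxE; case: unlift => // j; rewrite !mxE.
have [c qc] : exists c : 'rV_n.+1, emb R (k, y) = \sum_i c ord0 i *: emb R (P i).
  exists (emb R (k, y) *m invmx M).
  rewrite -{1}(mulmxKV uP (emb R (k, y))) -/M mulmx_sum_row.
  by apply: eq_bigr => i _; rewrite rowK.
have low i : - (k%:R * Q%:R) <= m%:R * c ord0 i.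
  by rewrite -natrM; apply/ltW; apply: (coord_gt R S P m Q C (k, y) (c ord0)).
have sumc : \sum_i m%:R * c ord0 i = k%:R.
  have := congr1 (fun v : 'rV_n.+1 => v ord0 ord0) qc; rewrite emb0 summxE => ->.
  by apply: eq_bigr => i _; rewrite mxE emb0 Pm mulrC.
have m1 : 1 <= m%:R :> R by rewrite ler1n.
have k0' : 0 < k%:R :> R by rewrite ltr0n.
have absc i : `|c ord0 i| <= D * k%:R.
  have kQ0 : 0 <= k%:R * Q%:R :> R by rewrite mulr_ge0.
  have up : m%:R * c ord0 i <= D * k%:R.
    have -> : m%:R * c ord0 i = k%:R - \sum_(j | j != i) m%:R * c ord0 j.
      by rewrite -sumc [in RHS](bigD1 i) //= addrK.
    rewrite mulrDl mul1r lerD2l lerNl.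
    apply: (@le_trans _ _ (\sum_(j < n.+1 | j != i) - (k%:R * Q%:R))); last first.
      by apply: ler_sum => j _; exact: low.
    rewrite sumrN lerN2 natrM -mulrA (mulrC Q%:R) (mulr_natl _ n.+1).
    have -> : (k%:R * Q%:R) *+ n.+1 = \sum_(j < n.+1) k%:R * Q%:R :> R.
      by rewrite sumr_const card_ord.
    rewrite [leRHS](bigID (fun j => j != i)) /=.
    by rewrite lerDl sumr_ge0.
  have lo : - (D * k%:R) <= m%:R * c ord0 i.
    apply: le_trans (low i); rewrite lerN2 mulrC ler_pM2r // /D natrM.
    have : 1 <= n.+1%:R :> R by rewrite ler1n.
    have : 0 <= Q%:R :> R by [].
    nra.
  rewrite ler_norml; apply/andP; split.
    case: (leP 0 (c ord0 i)) => [c0|c0]; last by nra.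
    by apply: le_trans c0; rewrite oppr_le0 mulr_ge0 // ltW.
  case: (leP 0 (c ord0 i)) => [c0|c0]; first by nra.
  by apply: le_trans (ltW c0) _; rewrite mulr_ge0 // ltW.
rewrite qc; apply: le_trans (ler_norm_sum _ _ _) _.
apply: (@le_trans _ _ (D * k%:R * \sum_i `|emb R (P i)|)).
  by rewrite mulr_sumr; apply: ler_sum => i _; rewrite normrZ ler_wpM2r.
by rewrite /B mulrAC [leRHS]mulrDl mul1r lerDr ltW.
Qed.

(** * Conic hulls and the norm bound on [Con] *)

Section ConicHull.
Context {R : realType} {m : nat}.
Implicit Types (A : set 'rV[R]_m) (v : 'rV[R]_m).

Lemma conic_hull0 A : conic_hull A 0.
Proof. by exists [::]; rewrite big_nil. Qed.

Lemma conic_hullD A v w : conic_hull A v -> conic_hull A w -> conic_hull A (v + w).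
Proof.
move=> [s [hs ->]] [s' [hs' ->]]; exists (s ++ s'); rewrite big_cat; split => // t.
by rewrite mem_cat => /orP[/hs|/hs'].
Qed.

Lemma conic_hullZ A a v : 0 <= a -> conic_hull A v -> conic_hull A (a *: v).
Proof.
move=> a0 [s [hs ->]]; exists [seq (a * t.1, t.2) | t <- s]; split.
  by move=> _ /mapP[t /hs[t0 At] ->]; split => //; rewrite mulr_ge0.
by rewrite big_map scaler_sumr; apply: eq_bigr => t _; rewrite scalerA.
Qed.

Lemma conic_hull_mono A A' v : A `<=` A' -> conic_hull A v -> conic_hull A' v.
Proof. by move=> AA' [s [hs ->]]; exists s; split => // t /hs[? /AA']. Qed.

End ConicHull.

Lemma closure_normP {R : realType} {m : nat} (A : set 'rV[R]_m) (v : 'rV[R]_m) (e : R) :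
  closure A v -> 0 < e -> exists2 h, A h & `|v - h| < e.
Proof.
move=> cl e0; have [h [Ah hb]] := cl _ (nbhsx_ballx v e e0).
by exists h => //; move: hb; rewrite -ball_normE.
Qed.

Lemma conic_hull_norm_le {R : realType} {n : nat} (S : set (lattice_pt n)) (B : R)
    (v : 'rV[R]_n.+1) :
  (forall q, S q -> `|emb R q| <= B * q.1%:R) ->
  conic_hull (emb R @` S) v -> `|v| <= B * v ord0 ord0.
Proof.
move=> hB [s [hs ->]]; apply: le_trans (ler_norm_sum _ _ _) _.
rewrite summxE mulr_sumr big_seq [leRHS]big_seq; apply: ler_sum => t /hs[t0 [q Sq <-]].
by rewrite normrZ ger0_norm // mxE emb0 mulrCA ler_wpM2l // hB.
Qed.

Lemma Con_norm_le {R : realType} {n : nat} (S : set (lattice_pt n)) (B : R)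
    (v : 'rV[R]_n.+1) :
  0 <= B -> (forall q, S q -> `|emb R q| <= B * q.1%:R) ->
  Con R S v -> `|v| <= B * v ord0 ord0.
Proof.
move=> B0 hB cv; apply/ler_addgt0Pr => e e0.
(* Replacing [v] by [h] costs one error in the norm and [B] errors in the level, hence the divisor
   [B + 1]. *)
have e1 : 0 < e / (B + 1) by rewrite divr_gt0 // ltr_wpDl.
have [h hh vh] := closure_normP _ _ _ cv e1.
have := conic_hull_norm_le S B h hB hh.
have := le_lt_trans (ler_coord_norm (v - h) ord0) vh.
have := ler_normD (v - h) h; rewrite subrK !mxE ltr_norml => h1 /andP[h2 h3] h4.
have e2 : e / (B + 1) * (B + 1) = e by rewrite divfK // gt_eqF // ltr_wpDl.
set d := e / (B + 1) in e1 e2 h1 h2 h3 vh.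
nra.
Qed.

Lemma Con_strict_bounded {R : realType} {n : nat} (S : set (lattice_pt n)) (B : R) :
  0 <= B -> (forall q, S q -> `|emb R q| <= B * q.1%:R) ->
  strictly_convex_cone (Con R S) /\ bounded_rV (Newton R S).
Proof.
move=> B0 hB; split.
  (* The levels of [v] and [- v] are opposite, so adding the two norm bounds gives [v = 0]. *)
  move=> v cv cnv; apply/eqP; rewrite -normr_le0.
  have := Con_norm_le S B _ B0 hB cv; have := Con_norm_le S B _ B0 hB cnv.
  by rewrite normrN mxE mulrN; lra.
exists B => y cy i; have := Con_norm_le S B _ B0 hB cy.
rewrite mxE unlift_none mulr1; apply: le_trans.
by apply: le_trans (ler_coord_norm _ (lift ord0 i)); rewrite mxE liftK.
Qed.

(** * Approximation by finitely generated cones *)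

Lemma conic_hull_coef {R : realType} {n : nat} (A : seq (lattice_pt n))
    (v : 'rV[R]_n.+1) :
  uniq A -> conic_hull (emb R @` [set` A]) v ->
  exists2 t : lattice_pt n -> R,
    forall p, 0 <= t p & v = \sum_(p <- A) t p *: emb R p.
Proof.
move=> uA [s [hs ->]]; elim: s hs => [|[a w] s ih] hs.
  by exists (fun=> 0) => //; rewrite big_nil big1 // => p _; rewrite scale0r.
have [|t t0 st] := ih; first by move=> x xs; apply: hs; rewrite inE xs orbT.
have [/= a0 [q qA qw]] := hs (a, w) (mem_head _ _).
exists (fun p => (if p == q then a else 0) + t p) => [p|].
  by rewrite addr_ge0 //; case: ifP.
rewrite big_cons /= st; under [RHS]eq_bigr do rewrite scalerDl.
rewrite big_split /=; congr (_ + _); rewrite (bigD1_seq q) //= eqxx qw big1 ?addr0 //.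
by move=> p /negbTE ->; rewrite scale0r.
Qed.

Lemma conic_hull_finite {R : realType} {n : nat} (S : set (lattice_pt n))
    (v : 'rV[R]_n.+1) :
  conic_hull (emb R @` S) v ->
  exists A : seq (lattice_pt n),
    (forall p, p \in A -> S p) /\ conic_hull (emb R @` [set` A]) v.
Proof.
move=> [s [hs ->]]; elim: s hs => [|[a w] s ih] hs.
  by exists [::]; rewrite big_nil; split => //; exact: conic_hull0.
have [|A [AS hA]] := ih; first by move=> x xs; apply: hs; rewrite inE xs orbT.
have [/= a0 [q Sq qw]] := hs (a, w) (mem_head _ _).
exists (q :: A); split; first by move=> p; rewrite inE => /orP[/eqP ->|/AS].
rewrite big_cons; apply: conic_hullD; last first.
  apply: conic_hull_mono hA; apply: image_subset => p /= pA.
  by rewrite inE pA orbT.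
exists [:: (a, w)]; rewrite big_seq1; split => // t; rewrite inE => /eqP ->; split => //=.
by exists q => //=; rewrite inE eqxx.
Qed.

Lemma conic_hull_finite_seq {R : realType} {n : nat} (S : set (lattice_pt n))
    (r : seq 'rV[R]_n.+1) :
  (forall v, v \in r -> conic_hull (emb R @` S) v) ->
  exists A : seq (lattice_pt n),
    (forall p, p \in A -> S p) /\
    (forall v, v \in r -> conic_hull (emb R @` [set` A]) v).
Proof.
elim: r => [|v r ih] hr; first by exists [::].
have [|A [AS hA]] := ih; first by move=> w wr; apply: hr; rewrite inE wr orbT.
have [A' [A'S hA']] := conic_hull_finite _ _ (hr v (mem_head _ _)).
exists (A' ++ A); split; first by move=> p; rewrite mem_cat => /orP[/A'S|/AS].
move=> w; rewrite inE => /orP[/eqP ->|/hA].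
  by apply: conic_hull_mono hA'; apply: image_subset => p /= pA; rewrite mem_cat pA.
by apply: conic_hull_mono; apply: image_subset => p /= pA; rewrite mem_cat pA orbT.
Qed.

(** The part of the hull at level at most 1 is bounded, so its closure is compact and is covered by
    finitely many balls of radius [d] centred in the hull. Each centre uses only finitely many
    generators. *)
Lemma conic_hull_net {R : realType} {n : nat} (S : set (lattice_pt n)) (B d : R) :
  0 <= B -> (forall q, S q -> `|emb R q| <= B * q.1%:R) -> 0 < d ->
  exists A : seq (lattice_pt n),
    (forall p, p \in A -> S p) /\
    (forall h, conic_hull (emb R @` S) h -> h ord0 ord0 <= 1 ->
       exists2 a, conic_hull (emb R @` [set` A]) a & `|h - a| <= d).
Proof.
move=> B0 hB d0; pose H := conic_hull (emb R @` S).
pose K := closure [set h | H h /\ h ord0 ord0 <= 1].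
have Hle h : H h -> h ord0 ord0 <= 1 -> `|h| <= B.
  move=> Hh h1; apply: le_trans (conic_hull_norm_le S B h hB Hh) _.
  by rewrite -[leRHS]mulr1 ler_wpM2l.
have Kcompact : compact K.
  apply: bounded_closed_compact; last exact: closed_closure.
  exists (B + 1); split; first exact: num_real.
  move=> x Bx v Kv; have [h [Hh h1] vh] := closure_normP _ _ _ Kv ltr01.
  apply/ltW; apply: le_lt_trans Bx.
  rewrite -[v](subrK h) addrC; apply: le_trans (ler_normD _ _) _.
  by rewrite lerD ?Hle // ltW.
have Kcov : K `<=` cover H (fun h => ball h d).
  move=> v Kv; have [h [Hh _] vh] := closure_normP _ _ _ Kv d0.
  by exists h => //; rewrite -ball_normE /ball_ /= distrC.
have [F FH KF] : finite_subset_cover H (fun h => ball h d) K.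
  move: Kcompact; rewrite compact_cover; apply => // h _.
  exact: ball_open.
have [|A [AS hA]] := conic_hull_finite_seq S (finmap.enum_fset F).
  by move=> v vF; have := FH v vF; rewrite inE.
exists A; split => // h Hh h1.
have [a aF ha] := KF h (subset_closure (conj Hh h1)).
exists a; first exact: hA.
by move: ha; rewrite -ball_normE /ball_ /= distrC => /ltW.
Qed.

Lemma bounded_int_span {n : nat} (A : seq (lattice_pt n)) (M : int) :
  (forall w, int_span A w) -> 0 <= M ->
  exists2 Z : int, 0 <= Z & forall w : 'rV[int]_n.+1, (forall i, `|w ord0 i| <= M) ->
    exists2 z : lattice_pt n -> int,
      w = \sum_(p <- A) lat p *~ z p & forall p, p \in A -> 0 <= Z + z p.
Proof.
move=> spanA M0.
have [z hz] := fin_all_exists (fun i : 'I_n.+1 => spanA (delta_mx ord0 i)).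
(* Fix an expansion of every unit vector; a vector with entries bounded by [M] then has coefficients
   at most this sum in absolute value. *)
exists (\sum_i M * \sum_(p <- A) `|z i p|).
  by apply: sumr_ge0 => i _; rewrite mulr_ge0 // sumr_ge0.
move=> w wM; exists (fun p => \sum_i w ord0 i * z i p).
  rewrite [LHS]row_sum_delta.
  under [RHS]eq_bigr do rewrite mulrz_sumr.
  rewrite exchange_big /=; apply: eq_bigr => i _.
  rewrite hz scaler_sumr; apply: eq_bigr => p _.
  by rewrite mulrC mulrzA -(scaler_int (w ord0 i)) intz.
move=> p pA; rewrite -big_split /=; apply: sumr_ge0 => i _.
rewrite -[w ord0 i * _]opprK subr_ge0; apply: le_trans (ler_norm _) _; rewrite normrN normrM.
apply: ler_pM => //; rewrite (big_rem p) //= lerDl.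
exact: sumr_ge0.
Qed.

(* Errors do not accumulate along the multiples of [w]: the defect of the
   approximation of [N w] is absorbed when the next copy of [w] is approximated. *)
Lemma conic_hull_approx {R : realType} {m : nat} (G : set 'rV[R]_m) (w : 'rV[R]_m)
    (r : R) :
  0 <= r ->
  (forall u, `|u - w| <= r -> exists2 a, conic_hull G a & `|u - a| <= r) ->
  exists2 a, conic_hull G a & `|w - a| <= 1.
Proof.
move=> r0 hr.
have approx N : exists2 a, conic_hull G a & `|w *+ N - a| <= r.
  elim: N => [|N [a Ga aN]].
    by exists 0; [exact: conic_hull0|rewrite mulr0n subr0 normr0].
  have [|b Gb bN] := hr (w + (w *+ N - a)); first by rewrite addrC addKr.
  exists (a + b); first exact: conic_hullD.
  by move: bN; rewrite mulrS opprD !addrA.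
(* With [N >= r], dividing by [N] brings the error down from [r] to at most 1. *)
pose N := (Num.bound r).+1.
have [a Ga aN] := approx N.
have N0 : 0 < N%:R :> R by rewrite ltr0n.
exists (N%:R^-1 *: a); first by apply: conic_hullZ => //; rewrite invr_ge0 ltW.
have -> : w - N%:R^-1 *: a = N%:R^-1 *: (w *+ N - a).
  by rewrite scalerBr -(scaler_nat N w) scalerA mulVf ?scale1r // gt_eqF.
rewrite normrZ gtr0_norm ?invr_gt0 // mulrC ler_pdivrMr // mul1r.
apply: le_trans aN _; apply: le_trans (ltW (archi_boundP r0)) _.
by rewrite ler_nat.
Qed.

(** * Balls around points far from the boundary *)

Lemma norm_closure {R : realType} {m : nat} (A : set 'rV[R]_m) (v : 'rV[R]_m) :
  (forall e : R, 0 < e -> exists2 h, A h & `|v - h| < e) -> closure A v.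
Proof.
move=> hA U /nbhs_ballP[e e0 eU]; have [h Ah vh] := hA e e0.
by exists h; split => //; apply: eU; rewrite -ball_normE.
Qed.

Lemma eucl_norm_le {R : realType} {m : nat} (v : 'rV[R]_m) :
  eucl_norm v <= m%:R * `|v|.
Proof.
have b0 : 0 <= m%:R * `|v| by rewrite mulr_ge0.
rewrite /eucl_norm -(ger0_norm b0) -sqrtr_sqr ler_sqrt ?sqr_ge0 //.
apply: (@le_trans _ _ (\sum_(i < m) `|v| ^+ 2)).
  apply: ler_sum => i _; rewrite -real_normK ?num_real //.
  by rewrite lerXn2r ?nnegrE // ler_coord_norm.
rewrite sumr_const card_ord exprMn -[leLHS]mulr_natl ler_wpM2r ?sqr_ge0 //.
by case: m {v b0} => [|m]; rewrite ?expr0n // -natrX ler_nat expnS leq_pmulr.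
Qed.

(** If [u] were outside [K], the last point of [K] on the segment from [v] to [u] would be a
    boundary point too close to [v]. The factor [m.+1] converts the sup norm of the ball into the
    Euclidean norm of [dist_to]. *)
Lemma deep_ball_subset {R : realType} {m : nat} (K : set 'rV[R]_m.+1)
    (v u : 'rV[R]_m.+1) (r : R) :
  closed K -> K v -> m.+1%:R * r < dist_to v (boundary K) -> `|u - v| <= r -> K u.
Proof.
move=> Kcl Kv far uv; apply: contrapT => Ku.
have Kid : closure K = K by apply/esym/closure_id.
pose seg (t : R) := v + t *: (u - v).
pose E : set R := [set t | 0 <= t <= 1 /\ K (seg t)].
have E0 : E 0 by split; rewrite ?lexx ?ler01 // /seg scale0r addr0.
have Eub : ubound E 1 by move=> t [/andP[]].
have supE : has_sup E by split; [exists 0|exists 1].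
pose t := sup E.
have t01 : 0 <= t <= 1.
  apply/andP; split; first by apply: ub_le_sup => //; exists 1.
  by apply: ge_sup => //; exists 0.
have segB a b : `|seg a - seg b| <= `|a - b| * r.
  by rewrite /seg opprD addrACA subrr add0r -scalerBl normrZ ler_wpM2l.
have r0 : 0 <= r by exact: le_trans uv.
(* The supremum is attained because [K] is closed. *)
have Kt : K (seg t).
  rewrite -Kid; apply: norm_closure => e e0.
  have e1 : 0 < e / (r + 1) by rewrite divr_gt0 // ltr_wpDl.
  have [s [s01 Ks] ts] := sup_adherent e1 supE.
  exists (seg s) => //; apply: le_lt_trans (segB _ _) _.
  have st : s <= t by apply: ub_le_sup; [exists 1|split].
  have e2 : e / (r + 1) * (r + 1) = e by rewrite divfK // gt_eqF // ltr_wpDl.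
  rewrite ger0_norm ?subr_ge0 //; move: ts; rewrite -/t.
  by set d := e / (r + 1) in e1 e2 *; nra.
have : boundary K (seg t).
  split; first by rewrite Kid.
  move=> /nbhs_ballP[e e0 eK].
  have tlt1 : t < 1.
    rewrite lt_neqAle; case/andP: t01 => _ ->; rewrite andbT; apply/eqP => t1.
    by apply: Ku; move: Kt; rewrite t1 /seg scale1r addrC subrK.
  (* If [seg t] were interior, the slightly larger parameter [a] would still belong to [E]. *)
  pose a := Num.min 1 (t + e / (r + 1)).
  have e1 : 0 < e / (r + 1) by rewrite divr_gt0 // ltr_wpDl.
  have ta : t < a by rewrite lt_min tlt1 ltrDl.
  suff Ea : E a by have := ub_le_sup (ex_intro _ 1 Eub) Ea; rewrite leNgt ta.
  split.
    by rewrite ge_min lexx /= (le_trans _ (ltW ta)) //; case/andP: t01.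
  apply: eK; rewrite -ball_normE /ball_ /= distrC; apply: le_lt_trans (segB _ _) _.
  have e2 : e / (r + 1) * (r + 1) = e by rewrite divfK // gt_eqF // ltr_wpDl.
  have : a <= t + e / (r + 1) by rewrite ge_min lexx orbT.
  rewrite gtr0_norm ?subr_gt0 //.
  by set d := e / (r + 1) in e1 e2 *; nra.
move=> bt; have : dist_to v (boundary K) <= eucl_norm (v - seg t).
  apply: ge_inf; last by exists (seg t).
  by exists 0 => _ [q _ <-]; exact: sqrtr_ge0.
rewrite leNgt => /negP; apply; apply: le_lt_trans far.
apply: le_trans (eucl_norm_le _) _; rewrite ler_wpM2l //.
rewrite /seg opprD addNKr normrN normrZ ger0_norm; last by case/andP: t01.
case/andP: t01 => t0 t1; apply: le_trans uv.
by rewrite -[leRHS]mul1r ler_wpM2r.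
Qed.

(** * Deep lattice points and the limit *)

Lemma deep_lattice_point_mem {R : realType} {n : nat} (S : set (lattice_pt n))
    (d : R) :
  is_subsemigroup S -> graded S -> ample S -> restricted_growth R S ->
  0 < d -> d <= 1 ->
  exists K0 : nat, forall k x, (0 < k)%N -> (K0 <= k)%N ->
    (forall u, `|u - emb R (k, x)| <= d * k%:R -> Con R S u) -> slice S k x.
Proof.
move=> Ssg gr am rg d0 d1.
have [B B0 hB] := semigroup_linear_bound R S Ssg gr am rg.
(* Points at level at most [3 * k] are rescaled to level at most 1, so the net error becomes
   [3 * k * (d / 12)], half of [rho]. *)
have d12 : 0 < d / 12 by rewrite divr_gt0.
have [A0 [A0S net]] := conic_hull_net S B (d / 12) (ltW B0) hB d12.
have [m m0 hm] := ample_pos S Ssg R gr rg am.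
have [/finite_seqP[r hr] _] := gr m m0.
have [_ [b Sb]] := gr 1%N isT.
have memr a : slice S m a <-> a \in r by rewrite hr.
(* The point at level 1 corrects levels, the slice at [m] generates level 0, and [A0] approximates
   the cone. *)
pose A := undup ((1%N, b) :: [seq (m, a) | a <- r] ++ A0).
have uA : uniq A by exact: undup_uniq.
have AS p : p \in A -> S p.
  rewrite mem_undup inE mem_cat => /orP[/eqP ->//|/orP[/mapP[a /memr Sa ->]//|]].
  exact: A0S.
have bA : (1%N, b) \in A by rewrite mem_undup mem_head.
have mA a : slice S m a -> (m, a) \in A.
  by move=> /memr ar; rewrite mem_undup inE mem_cat map_f ?orbT.
have spanA w : int_span A w.
  rewrite -[w](subrK (lat (1%N, b) *~ w ord0 ord0)); apply: int_spanD.
    apply: (int_span_level0 A S m) => //.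
    by rewrite !mxE -scaler_int mxE lat0 mulr1 intz subrr.
  by apply: int_spanMz; exact: int_span_mem.
have {net} netA h : conic_hull (emb R @` S) h -> h ord0 ord0 <= 1 ->
    exists2 a, conic_hull (emb R @` [set` A]) a & `|h - a| <= d / 12.
  move=> Hh h1; have [a ha ?] := net h Hh h1; exists a => //.
  apply: conic_hull_mono ha; apply: image_subset => p /= pA.
  by rewrite mem_undup inE mem_cat pA !orbT.
pose M0 : R := 1 + \sum_(p <- A) `|emb R p|.
have M00 : 0 <= M0 by rewrite addr_ge0 // sumr_ge0.
(* [M0] bounds the later remainder [W]: 1 for the distance to the cone of [A], and at most the norm
   of each generator for rounding its coefficient down. *)
pose M := (Num.bound M0)%:Z.
have [Z Z0 hZ] := bounded_int_span A M spanA isT.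
pose c0 : 'rV[R]_n.+1 := \sum_(p <- A) Z%:~R *: emb R p.
(* From this level on, subtracting [c0] uses up at most half of the depth [d * k]. *)
exists (Num.bound (2 * `|c0| / d)) => k x k0 kK deep.
have k0' : 0 < k%:R :> R by rewrite ltr0n.
have c0k : `|c0| <= d * k%:R / 2.
  have : 2 * `|c0| / d <= k%:R.
    apply: le_trans (ltW (archi_boundP _)) _; last by rewrite ler_nat.
    by rewrite divr_ge0 ?mulr_ge0 // ltW.
  by rewrite ler_pdivrMr //; lra.
pose v := emb R (k, x).
pose rho := d * k%:R / 2.
have dk0 : 0 < d * k%:R by rewrite mulr_gt0.
have [a ha wa] : exists2 a, conic_hull (emb R @` [set` A]) a & `|(v - c0) - a| <= 1.
  apply: (conic_hull_approx _ _ rho); first by rewrite /rho; lra.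
  move=> u uw; have uv : `|u - v| <= d * k%:R.
    have -> : u - v = (u - (v - c0)) - c0 by rewrite opprB addrAC subrKA.
    apply: le_trans (ler_normB _ _) _; rewrite /rho in uw; lra.
  have rho2 : 0 < rho / 2 by rewrite /rho; lra.
  have [h Hh uh] := closure_normP _ _ _ (deep u uv) rho2.
  have k3 : 0 < 3 * k%:R :> R by rewrite mulr_gt0.
  (* The level of [v] is [k], and passing to [u] and then to [h] adds at most [k] and [k / 4]. *)
  have h00 : h ord0 ord0 <= 3 * k%:R.
    have := le_trans (ler_coord_norm (u - v) ord0) uv.
    have := le_lt_trans (ler_coord_norm (u - h) ord0) uh.
    rewrite !mxE unlift_none /= ltr_norml ler_norml /rho => /andP[h1 _] /andP[_ h2].
    have : d * k%:R <= k%:R by rewrite -[leRHS]mul1r ler_wpM2r.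
    by rewrite /rho in h1; lra.
  have [||a ha hd] := netA ((3 * k%:R)^-1 *: h).
  - by apply: conic_hullZ => //; rewrite invr_ge0 ltW.
  - by rewrite mxE mulrC ler_pdivrMr // mul1r.
  exists ((3 * k%:R) *: a); first by apply: conic_hullZ => //; exact: ltW.
  have ha' : `|h - (3 * k%:R) *: a| <= rho / 2.
    have -> : h - (3 * k%:R) *: a = (3 * k%:R) *: ((3 * k%:R)^-1 *: h - a).
      by rewrite scalerBr scalerA mulfV ?scale1r // gt_eqF.
    rewrite normrZ gtr0_norm //; apply: le_trans (_ : 3 * k%:R * (d / 12) <= _).
      by rewrite ler_wpM2l // ltW.
    by rewrite /rho; lra.
  have -> : u - (3 * k%:R) *: a = (u - h) + (h - (3 * k%:R) *: a).
    by rewrite addrA subrK.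
  by apply: le_trans (ler_normD _ _) _; lra.
have [t t0 at_] := conic_hull_coef A a uA ha.
pose f p : int := Num.floor (t p).
have f0 p : 0 <= f p by rewrite floor_ge0.
pose W := lat (k, x) - \sum_(p <- A) lat p *~ (Z + f p).
have Wle i : `|W ord0 i| <= M.
  rewrite -(ler_int R) intr_norm.
  have -> : (W ord0 i)%:~R = map_mx (intr : int -> R) W ord0 i by rewrite [RHS]mxE.
  apply: le_trans (ler_coord_norm _ i) _.
  apply: le_trans (_ : M0 <= _); last exact: (ltW (archi_boundP M00)).
  have -> : map_mx intr W = ((v - c0) - a) + \sum_(p <- A) (t p - (f p)%:~R) *: emb R p.
    rewrite /W raddfB /= map_lat_sum -emb_lat -/v.
    under [in LHS]eq_bigr do rewrite intrD scalerDl.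
    rewrite big_split /= -/c0 at_.
    under [in RHS]eq_bigr do rewrite scalerBl.
    by rewrite [in RHS]big_split /= sumrN opprD !addrA subrK.
  apply: le_trans (ler_normD _ _) _; rewrite lerD //.
  apply: le_trans (ler_norm_sum _ _ _) _; apply: ler_sum => p _.
  rewrite normrZ -[leRHS]mul1r ler_wpM2r //.
  have := floor_itv (t p); rewrite -/(f p) intrD => /andP[h1 h2].
  by rewrite ger0_norm ?subr_ge0 //; lra.
have [z Wz zZ] := hZ W Wle.
(* The coefficients [Z + f p + z p] are nonnegative since [f p >= 0] and [Z + z p >= 0]. *)
have latS : lat (k, x) = \sum_(p <- A) lat p *+ absz (Z + f p + z p).
  have -> : lat (k, x) = \sum_(p <- A) lat p *~ (Z + f p + z p).
    under eq_bigr do rewrite mulrzDr.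
    by rewrite big_split /= -Wz /W addrC subrK.
  rewrite big_seq [RHS]big_seq; apply: eq_bigr => p pA.
  rewrite pmulrn gez0_abs // addrAC addr_ge0 //; exact: zZ.
rewrite -[x](tail_lat (k, x)); apply: monoid_of_slice => //; last exact: lat0.
rewrite latS big_seq; apply: monoid_of_sum => // p pA.
by apply: monoid_ofMn => //; apply: monoid_of_lat; exact: AS.
Qed.

Theorem mainTheorem6 (R : realType) (n : nat) (S : set (lattice_pt n)) :
  is_subsemigroup S -> graded S -> ample S -> restricted_growth R S ->
  (strictly_convex_cone (Con R S) /\ bounded_rV (Newton R S)) /\
  ((fun k : nat => dfun R S k / k%:R) @ \oo --> (0 : R)).
Proof.
move=> Ssg gr am rg; split.
  have [B B0 hB] := semigroup_linear_bound R S Ssg gr am rg.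
  exact: (Con_strict_bounded S B (ltW B0) hB).
apply/cvgrPdist_le => e e0.
(* Since [n.+1 * d <= e], a point at distance more than [e * k] from the boundary has the ball of
   radius [d * k] around it inside [Con]. *)
pose d := Num.min 1 (e / n.+1%:R).
have d0 : 0 < d by rewrite lt_min ltr01 divr_gt0 // ltr0n.
have d1 : d <= 1 by rewrite ge_min lexx.
have de : n.+1%:R * d <= e by rewrite mulrC -ler_pdivlMr ?ltr0n // ge_min lexx orbT.
have [K0 hK0] := deep_lattice_point_mem S d Ssg gr am rg d0 d1.
near=> k; have k0 : (0 < k)%N by near: k; exact: nbhs_infty_gt.
have kK : (K0 <= k)%N by near: k; exact: nbhs_infty_ge.
have k0' : 0 < k%:R :> R by rewrite ltr0n.
rewrite /dfun; set E := ([set 0] `|` _).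
have Eub : ubound E (e * k%:R).
  move=> _ [->|[x [Mx Sx] <-]]; first by rewrite mulr_ge0 // ltW.
  rewrite leNgt; apply/negP => far; apply: Sx; apply: hK0 => // u.
  apply: deep_ball_subset => //; first exact: closed_closure.
  by apply: le_lt_trans far; rewrite mulrA ler_wpM2r.
have E0 : E 0 by left.
have s0 : 0 <= sup E by apply: ub_le_sup => //; exists (e * k%:R).
have se : sup E <= e * k%:R by apply: ge_sup => //; exists 0.
rewrite sub0r normrN ger0_norm; last by rewrite divr_ge0.
by rewrite ler_pdivrMr.
Unshelve. all: by end_near.
Qed.
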